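(* For the homogeneous models $\mathsf{M9}$, $\mathsf{M8}$, $\mathsf{M7}_{\mathsf a}$ ($\mathsf a\in\mathbb C$), $\mathsf{M6S}$, $\mathsf{M6N}$ of (complexified) $4$-dimensional split-conformal structures, given by the Cartan-theoretic data $(\mathfrak f,\kappa)$ in the context, the (complexified) conformal holonomy algebra $\mathfrak{hol}\subset\mathfrak{sl}(4,\mathbb C)$ is as follows ($*$ denotes arbitrary entries subject to total trace zero): - $\mathsf{M9}$: $\mathfrak{hol}=\left\{\begin{pmatrix}0&0&0&0\\ *&0&0&0\\ *&0&0&0\\ *&0&0&0\end{pmatrix}\right\}$. - $\mathsf{M8}$: $\mathfrak{hol}=\left\{\begin{pmatrix}s_1&s_2&\frac{c_4}2&-\frac{c_2}2\\ s_3&-s_1&-\frac{c_3}2&\frac{c_1}2\\ c_1&c_2&t_1&t_2\\ c_3&c_4&t_3&-t_1\end{pmatrix}\right\}\cong\mathfrak{sp}(4,\mathbb C)$. - $\mathsf{M7}_{\mathsf a}$ with $\mathsf a^2\neq\frac43$: $\mathfrak{hol}=\left\{\begin{pmatrix}0&0&0&0\\ *&0&0&0\\ *&0&0&0\\ *&*&*&0\end{pmatrix}\right\}$. - $\mathsf{M7}_{\mathsf a}$ with $\mathsf a^2=\frac43$: $\mathfrak{hol}=\left\{\begin{pmatrix}0&0&0&0\\ *&0&0&0\\ *&0&0&0\\ *&0&0&0\end{pmatrix}\right\}$. - $\mathsf{M6S}$: $\mathfrak{hol}=\mathfrak{sl}(4,\mathbb C)$. - $\mathsf{M6N}$: $\mathfrak{hol}=\left\{\begin{pmatrix}*&0&0&0\\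 *&*&*&*\\ *&*&*&*\\ *&*&*&*\end{pmatrix}\right\}\subset\mathfrak{sl}(4,\mathbb C)$.
   Context: Let $\widetilde{\mathfrak g}=\mathfrak{sl}(4,\mathbb C)$ and let $\widetilde{\mathfrak q}$ be the parabolic subalgebra of matrices whose bottom-left $2\times2$ block vanishes (the stabilizer of $\langle e_1,e_2\rangle$); $4$-dimensional (complexified) split-conformal geometry is Cartan geometry of type $(\widetilde{\mathfrak g},\widetilde{\mathfrak q})$. A homogeneous structure is encoded by a Cartan-theoretic model: a linear subspace $\mathfrak f\subset\widetilde{\mathfrak g}$ projecting onto $\widetilde{\mathfrak g}/\widetilde{\mathfrak q}$, with $\mathfrak f^0=\mathfrak f\cap\widetilde{\mathfrak q}$, and a curvature $\kappa\in\Lambda^2(\widetilde{\mathfrak g}/\widetilde{\mathfrak q})^*\otimes\widetilde{\mathfrak g}$ such that $[x,y]_{\mathfrak f}:=[x,y]-\kappa(x,y)$ is a Lie bracket on $\mathfrak f$ (with $\kappa$ regular and normal). The conformal holonomy algebra of the model (the infinitesimal holonomy algebra of its Cartan connection) is $\mathfrak{hol}=\bigcup_i\mathfrak{hol}^i$, where $\mathfrak{hol}^0=\langle\kappa(x,y):x,y\in\mathfrak f\rangle$ and $\mathfrak{hol}^i=\mathfrak{hol}^{i-1}+[\mathfrak f,\mathfrak{hol}^{i-1}]$ for $i\ge1$ (brackets in $\widetilde{\mathfrak g}$). Let $E_{ij}$ be the matrix units, $H_{ij}=E_{ii}-E_{jj}$, and for $i\in\{3,4\}$, $j\in\{1,2\}$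 let $E_{ij}^*$ be the functional on $\widetilde{\mathfrak g}/\widetilde{\mathfrak q}$ returning the $(i,j)$ entry. $(\alpha\wedge\beta\otimes v)(x,y)=(\alpha(x)\beta(y)-\alpha(y)\beta(x))v$. Put $\phi_0=E_{32}^*\wedge E_{42}^*\otimes E_{21}$, $\phi_1=(E_{31}^*\wedge E_{42}^*+E_{32}^*\wedge E_{41}^* )\otimes E_{21}+E_{32}^*\wedge E_{42}^*\otimes H_{12}$, $\phi_2=E_{31}^*\wedge E_{41}^*\otimes E_{21}+E_{42}^*\wedge E_{32}^*\otimes E_{12}+(E_{31}^*\wedge E_{42}^*+E_{32}^*\wedge E_{41}^* )\otimes H_{12}$, $\psi_0=E_{32}^*\wedge E_{31}^*\otimes E_{43}$, $\psi_2=E_{42}^*\wedge E_{41}^*\otimes E_{43}+E_{31}^*\wedge E_{32}^*\otimes E_{34}+(E_{42}^*\wedge E_{31}^*+E_{32}^*\wedge E_{41}^* )\otimes H_{43}$. The models ($\mathfrak f$ is the space of matrices displayed, with all letters other than $\mathsf a,f,g$ arbitrary complex parameters): $\mathsf{M9}$: $\begin{pmatrix}2z&0&0&0\\ a_3&0&0&0\\ a_4&a_1&-z+h&s\\ a_5&a_2&t&-z-h\end{pmatrix}$, $\kappa=\phi_0$. $\mathsf{M8}$: $\begin{pmatrix}s&0&\frac{a_2}2&-\frac{a_1}2\\0&-s&-\frac{a_4}2&\frac{a_3}2\\ a_3&a_1&t_1&t_2\\ a_4&a_2&t_3&-t_1\end{pmatrix}$, $\kappa=\phi_2$. $\mathsf{M7}_{\mathsf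 a}$: $\begin{pmatrix}z-ga_1&0&0&0\\ a_3&ga_1&fa_1&0\\ a_4&a_1&ga_1&0\\ a_5&a_2&t&-z-ga_1\end{pmatrix}$ with $f=\frac{\mathsf a^2}4+5$, $g=-\frac{\mathsf a}2$, and $\kappa=\phi_0+12(\mathsf a^2-\frac43)\psi_0$. $\mathsf{M6S}$: $\begin{pmatrix}s_1&0&\frac{11}6a_2&\frac{19}6a_1\\0&-s_1&\frac{19}6a_4&\frac{11}6a_3\\ a_3&a_1&s_2&0\\ a_4&a_2&0&-s_2\end{pmatrix}$, $\kappa=-\frac43\phi_2+\frac43\psi_2$. $\mathsf{M6N}$: $\begin{pmatrix}\frac{3z}2-\frac{b_1}2&0&0&0\\ \frac{b_3}4&-\frac z2+\frac{b_1}2&-\frac{5b_1}{48}-5b_2&5b_1\\ b_3&b_1&-\frac{b_1}6-16b_2-\frac z2&16b_1\\ b_4&b_2&t&\frac{b_1}6+16b_2-\frac z2\end{pmatrix}$, $\kappa=\phi_1$. *)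

(* Defs.v *)
From HB Require Import structures.
From mathcomp Require Import all_boot all_order all_algebra.
From mathcomp Require Import boolp classical_sets functions reals complex.

Set Implicit Arguments.
Unset Strict Implicit.
Unset Printing Implicit Defensive.

Import Order.TTheory GRing.Theory Num.Theory.

Local Open Scope classical_set_scope.
Local Open Scope ring_scope.

Section LieAlgebras.
Variable K : fieldType.

Definition lin_span (V : lmodType K) (S : set V) : set V :=
  [set v | exists (n : nat) (c : 'I_n -> K) (x : 'I_n -> V),
     (forall i, S (x i)) /\ v = \sum_i c i *: x i].

Definition set_add (V : lmodType K) (A B : set V) : set V :=
  [set u + v | u in A & v in B].

Definition lieb (n : nat) (x y : 'M[K]_n) : 'M[K]_n := x *m y - y *m x.

Definition lie_span (n : nat) (A B : set 'M[K]_n) : set 'M[K]_n :=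
  lin_span [set lieb x y | x in A & y in B].

Definition lie_subalgebra (n : nat) (A : set 'M[K]_n) : Prop :=
  [/\ A 0,
      forall (c : K) x y, A x -> A y -> A (c *: x + y)
    & forall x y, A x -> A y -> A (lieb x y)].

(* Only the restriction of [phi] to [A] is meaningful. *)
Definition lie_isomorphic (m n : nat) (A : set 'M[K]_m) (B : set 'M[K]_n) :
    Prop :=
  [/\ lie_subalgebra A, lie_subalgebra B
    & exists phi : 'M[K]_m -> 'M[K]_n,
      [/\ set_bij A B phi,
          forall (c : K) x y, A x -> A y ->
            phi (c *: x + y) = c *: phi x + phi y
        & forall x y, A x -> A y -> phi (lieb x y) = lieb (phi x) (phi y)]].

Definition sl4 : set 'M[K]_4 := [set x | \tr x = 0].

Definition sp4 : set 'M[K]_4 :=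
  let J : 'M[K]_4 := block_mx (0 : 'M[K]_2) 1%:M (- 1%:M) 0 in
  [set x | x^T *m J + J *m x = 0].

End LieAlgebras.

(* The algebraic data entering the holonomy: the space f and the curvature.
   The curvature is a function on pairs of representatives; the ones below
   depend only on the classes modulo the parabolic q, since they are built from
   the entries of the bottom-left 2x2 block. *)
Record cartan_data (K : fieldType) := CartanData {
  cspace : set 'M[K]_4;
  curvature : 'M[K]_4 -> 'M[K]_4 -> 'M[K]_4
}.

Section Holonomy.
Variables (K : fieldType) (M : cartan_data K).

Fixpoint hol_step (i : nat) : set 'M[K]_4 :=
  if i is j.+1 then
    set_add (hol_step j) (lie_span (cspace M) (hol_step j))
  else
    lin_span [set curvature M x y | x in cspace M & y in cspace M].

Definition hol : set 'M[K]_4 := \bigcup_i hol_step i.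

End Holonomy.

Section Models.
Variable K : fieldType.

Definition mx4 (rows : seq (seq K)) : 'M[K]_4 :=
  \matrix_(i, j) nth 0 (nth [::] rows i) j.

(* Indices run from 1 to 4 in [E], [H] and [Edual]. *)
Definition idx (i : nat) : 'I_4 := inord i.-1.

Definition E (i j : nat) : 'M[K]_4 := delta_mx (idx i) (idx j).

Definition H (i j : nat) : 'M[K]_4 := E i i - E j j.

Definition Edual (i j : nat) (x : 'M[K]_4) : K := x (idx i) (idx j).

Definition wedge (al be : 'M[K]_4 -> K) (x y : 'M[K]_4) : K :=
  al x * be y - al y * be x.

Definition phi0 (x y : 'M[K]_4) : 'M[K]_4 :=
  wedge (Edual 3 2) (Edual 4 2) x y *: E 2 1.

Definition phi1 (x y : 'M[K]_4) : 'M[K]_4 :=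
  (wedge (Edual 3 1) (Edual 4 2) x y
     + wedge (Edual 3 2) (Edual 4 1) x y) *: E 2 1
  + wedge (Edual 3 2) (Edual 4 2) x y *: H 1 2.

Definition phi2 (x y : 'M[K]_4) : 'M[K]_4 :=
  wedge (Edual 3 1) (Edual 4 1) x y *: E 2 1
  + wedge (Edual 4 2) (Edual 3 2) x y *: E 1 2
  + (wedge (Edual 3 1) (Edual 4 2) x y
       + wedge (Edual 3 2) (Edual 4 1) x y) *: H 1 2.

Definition psi0 (x y : 'M[K]_4) : 'M[K]_4 :=
  wedge (Edual 3 2) (Edual 3 1) x y *: E 4 3.

Definition psi2 (x y : 'M[K]_4) : 'M[K]_4 :=
  wedge (Edual 4 2) (Edual 4 1) x y *: E 4 3
  + wedge (Edual 3 1) (Edual 3 2) x y *: E 3 4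
  + (wedge (Edual 4 2) (Edual 3 1) x y
       + wedge (Edual 3 2) (Edual 4 1) x y) *: H 4 3.

Definition M9 : cartan_data K := {|
  cspace := [set x | exists z h s t a1 a2 a3 a4 a5 : K,
    x = mx4 [:: [:: 2 * z;  0;       0;   0];
                [::    a3;  0;       0;   0];
                [::    a4; a1; - z + h;   s];
                [::    a5; a2;       t; - z - h] ]];
  curvature := phi0 |}.

Definition M8 : cartan_data K := {|
  cspace := [set x | exists s t1 t2 t3 a1 a2 a3 a4 : K,
    x = mx4 [:: [::  s;   0;     a2 / 2; - (a1 / 2)];
                [::  0; - s; - (a4 / 2);     a3 / 2];
                [:: a3;  a1;         t1;         t2];
                [:: a4;  a2;         t3;       - t1] ]];
  curvature := phi2 |}.

Definition M7 (a : K) : cartan_data K :=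
  let f := a ^+ 2 / 4 + 5 in
  let g := - (a / 2) in
  {|
  cspace := [set x | exists z t a1 a2 a3 a4 a5 : K,
    x = mx4 [:: [:: z - g * a1;      0;      0;            0];
                [::         a3; g * a1; f * a1;            0];
                [::         a4;     a1; g * a1;            0];
                [::         a5;     a2;      t; - z - g * a1] ]];
  curvature := fun x y =>
    phi0 x y + (12 * (a ^+ 2 - 4 / 3)) *: psi0 x y |}.

Definition M6S : cartan_data K := {|
  cspace := [set x | exists s1 s2 a1 a2 a3 a4 : K,
    x = mx4 [:: [:: s1;    0; 11 / 6 * a2; 19 / 6 * a1];
                [::  0; - s1; 19 / 6 * a4; 11 / 6 * a3];
                [:: a3;   a1;          s2;           0];
                [:: a4;   a2;           0;        - s2] ]];
  curvature := fun x y => (- (4 / 3)) *: phi2 x y + (4 / 3) *: psi2 x y |}.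

Definition M6N : cartan_data K := {|
  cspace := [set x | exists z t b1 b2 b3 b4 : K,
    x = mx4
      [:: [:: 3 * z / 2 - b1 / 2; 0; 0; 0];
          [:: b3 / 4; - (z / 2) + b1 / 2; - (5 * b1 / 48) - 5 * b2; 5 * b1];
          [:: b3; b1; - (b1 / 6) - 16 * b2 - z / 2; 16 * b1];
          [:: b4; b2; t; b1 / 6 + 16 * b2 - z / 2] ]];
  curvature := phi1 |}.

End Models.

(* Main.v *)
Require Import Defs.
From HB Require Import structures.
From mathcomp Require Import all_boot all_order all_algebra.
From mathcomp Require Import boolp classical_sets functions reals complex.
From mathcomp Require Import ring.

Set Implicit Arguments.
Unset Strict Implicit.
Unset Printing Implicit Defensive.

Import Order.TTheory GRing.Theory Num.Theory.

Local Open Scope classical_set_scope.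
Local Open Scope ring_scope.

(** The holonomy algebra of a model [(f, kappa)] is the smallest linear subspace
    of the 4x4 matrices that contains the values of the curvature on [f] and is
    stable under bracketing with elements of [f]: every stage of the increasing
    union is forced into such a subspace, and the union itself is one
    ([hol_stable_hol], [hol_min], combined in [hol_eq]). Each of the six
    computations therefore splits into two finite verifications.

    The upper bound checks that the displayed space is stable, by computing a
    curvature value and a bracket of matrices with generic entries. The lower
    bound exhibits, inside an arbitrary stable subspace [B], a basis of the
    displayed space, each vector being a combination of curvature values,
    brackets with [f], and vectors found before.

    - [M9], and [M7] with vanishing [psi0] term: the curvature gives [E21], and
      bracketing with the elements of [f] having entry 1 in position (3,2) or
      (4,2) moves it down the first column. When the [psi0] term survives, the
      curvature also gives [E43], from which [E42] follows.
    - [M8]: the curvature gives the upper left copy of sl(2). Its [H12] acts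
      with eigenvalues 1 and -1 on the part of [f] with vanishing diagonal
      blocks, so that part lies in the holonomy, and its brackets produce the
      lower right sl(2). The displayed algebra is that of the infinitesimal
      symmetries of an alternating form ([hol8E]), and forms related by a change
      of basis have isomorphic algebras ([form_algebra_congruence]).
    - [M6S]: the curvature gives both diagonal copies of sl(2). Bracketing the
      four mixed elements of [f] with [E34] and [E43] yields each mixed plane of
      matrix units from two vectors with distinct coefficient ratios, 19/6 and
      -11/6 or 11/6 and -19/6, hence all matrix units.
    - [M6N]: the first column is generated as for [M9], and the other nine
      dimensions come from [H12] by a chain of brackets with [E43] and with the
      elements of [f] whose only nonzero parameter is [b1] or [b2]. *)

(** * Subspaces and the universal property of the holonomy algebra *)

Definition subspace (K : fieldType) (V : lmodType K) (A : set V) : Prop :=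
  A 0 /\ forall (c : K) x y, A x -> A y -> A (c *: x + y).

Definition hol_stable (K : fieldType) (M : cartan_data K) (A : set 'M[K]_4) :
    Prop :=
  [/\ subspace A,
      forall x y, cspace M x -> cspace M y -> A (curvature M x y)
    & forall x y, cspace M x -> A y -> A (lieb x y)].

Section Subspaces.
Variables (K : fieldType) (V : lmodType K) (A : set V).
Hypothesis subA : subspace A.

Lemma subspaceD x y : A x -> A y -> A (x + y).
Proof. by move=> Ax Ay; rewrite -[x]scale1r; apply: subA.2. Qed.

Lemma subspaceZ c x : A x -> A (c *: x).
Proof.
by move=> Ax; rewrite -[_ *: _]addr0; apply: subA.2 => //; exact: subA.1.
Qed.

Lemma subspaceB x y : A x -> A y -> A (x - y).
Proof. by move=> Ax Ay; rewrite -scaleN1r addrC; apply: subA.2. Qed.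

Lemma lin_span_min (S : set V) : S `<=` A -> lin_span S `<=` A.
Proof.
move=> SA _ [n [c [x [Sx ->]]]].
elim/big_ind: _ => [|u v|i _]; [exact: subA.1 | exact: subspaceD |].
exact/subspaceZ/SA.
Qed.

End Subspaces.

Section Spans.
Variables (K : fieldType) (V : lmodType K).

Lemma lin_span_gen (S : set V) : S `<=` lin_span S.
Proof.
move=> x Sx; exists 1, (fun=> 1), (fun=> x); split=> //.
by rewrite big_ord1 scale1r.
Qed.

Lemma subspace_span (S : set V) : subspace (lin_span S).
Proof.
split=> [|c _ _ [m [a [x [Sx ->]]]] [n [b [y [Sy ->]]]]].
  by exists 0, (fun=> 0), (fun=> 0); split=> [[]|] //; rewrite big_ord0.
exists (m + n)%N,
  (fun i => match fintype.split i with inl j => c * a j | inr j => b j end),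
  (fun i => match fintype.split i with inl j => x j | inr j => y j end).
split=> [i|]; first by case: fintype.split.
rewrite big_split_ord scaler_sumr /=; congr (_ + _); apply: eq_bigr => i _.
  by rewrite (unsplitK (inl i)) scalerA.
by rewrite (unsplitK (inr i)).
Qed.

Lemma subspace_add (A B : set V) :
  subspace A -> subspace B -> subspace (set_add A B).
Proof.
move=> sA sB; split.
  by exists 0; [exact: sA.1 | exists 0; [exact: sB.1 | exact: addr0]].
move=> c _ _ [a Aa [b Bb <-]] [a' Aa' [b' Bb' <-]].
exists (c *: a + a'); first exact: sA.2.
by exists (c *: b + b'); [exact: sB.2 | rewrite scalerDr addrACA].
Qed.

End Spans.

Section HolonomyClosure.
Variables (K : fieldType) (M : cartan_data K).

Lemma subspace_hol_step i : subspace (hol_step M i).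
Proof.
elim: i => [|i IH]; first exact: subspace_span.
exact: subspace_add IH (subspace_span _).
Qed.

Lemma hol_step_mono i j : (i <= j)%N -> hol_step M i `<=` hol_step M j.
Proof.
move=> /subnK <-; elim: (j - i)%N => [|k IH] x // /IH kx.
by exists x => //; exists 0; [exact: (subspace_span _).1 | exact: addr0].
Qed.

(** A bracket of [f] with stage [i] lies in stage [i + 1], and finitely many
    members of the union already lie in a common stage. *)
Lemma hol_stable_hol : hol_stable M (hol M).
Proof.
split.
- split=> [|c x y [i _ ix] [j _ jy]].
    by exists 0 => //; exact: (subspace_hol_step 0).1.
  exists (maxn i j) => //; apply: (subspace_hol_step _).2.
    by apply: hol_step_mono ix; exact: leq_maxl.
  by apply: hol_step_mono jy; exact: leq_maxr.
- move=> x y fx fy; exists 0 => //.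
  by apply: lin_span_gen; exists x => //; exists y.
- move=> x y fx [i _ iy]; exists i.+1 => //.
  exists 0; first exact: (subspace_hol_step i).1.
  exists (lieb x y); last exact: add0r.
  by apply: lin_span_gen; exists x => //; exists y.
Qed.

Lemma hol_min (A : set 'M[K]_4) : hol_stable M A -> hol M `<=` A.
Proof.
case=> sA cA bA x [i _]; elim: i x => [|i IH] x /=.
  by apply: lin_span_min => // _ [u fu [v fv <-]]; exact: cA.
move=> [u /IH Au [v Bv <-]]; apply: subspaceD => //.
by apply: lin_span_min Bv => // _ [y fy [z /IH Az <-]]; exact: bA.
Qed.

(** Quantifying over every stable [B] lets the lower bounds be derived from the
    closure properties alone, without tracking the stages. *)
Lemma hol_eq (A : set 'M[K]_4) :
  hol_stable M A -> (forall B, hol_stable M B -> A `<=` B) -> hol M = A.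
Proof.
move=> sA minA; apply/seteqP; split; first exact: hol_min.
by apply: minA; exact: hol_stable_hol.
Qed.

End HolonomyClosure.

(** * Computing with explicit 4x4 matrices *)

Section ExplicitMatrices.
Variable K : fieldType.
Implicit Types r s : seq (seq K).

Definition entry r (i j : nat) : K := nth 0 (nth [::] r i) j.

(** The sixteen entries are listed outright, so that each operation below sends
    literal tables to literal tables by mere reduction. *)
Definition table (F : nat -> nat -> K) : seq (seq K) :=
  [:: [:: F 0 0; F 0 1; F 0 2; F 0 3]; [:: F 1 0; F 1 1; F 1 2; F 1 3];
      [:: F 2 0; F 2 1; F 2 2; F 2 3]; [:: F 3 0; F 3 1; F 3 2; F 3 3] ]%N.

Lemma mx4_table (F : nat -> nat -> K) (A : 'M[K]_4) :
  (forall i j : 'I_4, A i j = F i j) -> A = mx4 (table F).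
Proof.
move=> AF; apply/matrixP => i j; rewrite mxE AF.
by case: i j => [[|[|[|[|i]]]] //= _] [[|[|[|[|j]]]] //= _].
Qed.

Lemma mx4P (A : 'M[K]_4) :
  exists a11 a12 a13 a14 a21 a22 a23 a24 a31 a32 a33 a34 a41 a42 a43 a44 : K,
  A = mx4 [:: [:: a11; a12; a13; a14]; [:: a21; a22; a23; a24];
              [:: a31; a32; a33; a34]; [:: a41; a42; a43; a44] ].
Proof.
have := mx4_table (F := fun i j => A (inord i) (inord j)) (A := A).
rewrite /table => -> => [|i j]; last by rewrite !inord_val.
by do 16 eexists.
Qed.

Lemma mx4D r s :
  mx4 r + mx4 s = mx4 (table (fun i j => entry r i j + entry s i j)).
Proof. by apply: mx4_table => i j; rewrite !mxE. Qed.

Lemma mx4N r : - mx4 r = mx4 (table (fun i j => - entry r i j)).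
Proof. by apply: mx4_table => i j; rewrite !mxE. Qed.

Lemma mx4Z c r : c *: mx4 r = mx4 (table (fun i j => c * entry r i j)).
Proof. by apply: mx4_table => i j; rewrite !mxE. Qed.

Lemma mx4M r s :
  mx4 r *m mx4 s = mx4 (table (fun i j =>
    entry r i 0 * entry s 0 j + entry r i 1 * entry s 1 j +
    entry r i 2 * entry s 2 j + entry r i 3 * entry s 3 j)).
Proof.
apply: mx4_table => i j; rewrite mxE !big_ord_recl big_ord0 addr0 !mxE /=.
by rewrite !addrA.
Qed.

Lemma mx4T r : (mx4 r)^T = mx4 (table (fun i j => entry r j i)).
Proof. by apply: mx4_table => i j; rewrite !mxE. Qed.

Lemma mx4_0 : 0 = mx4 (table (fun _ _ => 0)) :> 'M[K]_4.
Proof. by apply: mx4_table => i j; rewrite mxE. Qed.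

Lemma mx4_tr r :
  \tr (mx4 r) = entry r 0 0 + entry r 1 1 + entry r 2 2 + entry r 3 3.
Proof. by rewrite /mxtrace !big_ord_recl big_ord0 addr0 !mxE /= !addrA. Qed.

Lemma mx4_E i j : (0 < i <= 4)%N -> (0 < j <= 4)%N ->
  E K i j = mx4 (table (fun k l => (eqn k.+1 i && eqn l.+1 j)%:R)).
Proof.
case: i j => [//|i] [|j] // i4 j4; apply: mx4_table => k l.
by rewrite mxE -!val_eqE /= !inordK // !eqSS.
Qed.

Lemma Edual_mx4 i j r : (0 < i <= 4)%N -> (0 < j <= 4)%N ->
  Edual i j (mx4 r) = entry r i.-1 j.-1.
Proof.
move=> /andP[i0 i4] /andP[j0 j4].
by rewrite /Edual mxE !inordK ?prednK.
Qed.

End ExplicitMatrices.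

(** With the row and column numbering 1 to 4 of the curvature formulas. *)
Definition minor (K : fieldType) (r s : seq (seq K)) (i j k l : nat) : K :=
  entry r i.-1 j.-1 * entry s k.-1 l.-1 - entry s i.-1 j.-1 * entry r k.-1 l.-1.

Lemma wedge_mx4 (K : fieldType) i j k l (r s : seq (seq K)) :
  (0 < i <= 4)%N -> (0 < j <= 4)%N -> (0 < k <= 4)%N -> (0 < l <= 4)%N ->
  wedge (Edual i j) (Edual k l) (mx4 r) (mx4 s) = minor r s i j k l.
Proof. by move=> *; rewrite /wedge !Edual_mx4. Qed.

(** The innermost operation goes first, because only literal tables match, and
    the resulting table is reduced at once: every further operation would copy
    its unreduced entries many times. *)
Ltac mx4_op :=
  match goal with
  | |- context [Defs.E ?K ?i ?j] => rewrite (@mx4_E K i j) //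
  | |- context [@GRing.add _ (mx4 ?r) (mx4 ?s)] => rewrite (mx4D r s)
  | |- context [@GRing.opp _ (mx4 ?r)] => rewrite (mx4N r)
  | |- context [@GRing.scale _ _ ?c (mx4 ?r)] => rewrite (mx4Z c r)
  | |- context [mx4 ?r *m mx4 ?s] => rewrite (mx4M r s)
  | |- context [(mx4 ?r)^T] => rewrite (mx4T r)
  | |- context [\tr (mx4 ?r)] => rewrite (mx4_tr r)
  end;
  cbv beta iota zeta delta [table minor entry nth eqn andb nat_of_bool predn].

Ltac mx4_ops := rewrite /H; repeat mx4_op.

Ltac mx4_congr :=
  congr (mx4 [:: [:: _; _; _; _]; [:: _; _; _; _];
                 [:: _; _; _; _]; [:: _; _; _; _] ]).

Section ExplicitCurvature.
Variable K : fieldType.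
Implicit Types r s : seq (seq K).

Lemma phi0_mx4 r s : phi0 (mx4 r) (mx4 s) =
  mx4 [:: [:: 0; 0; 0; 0]; [:: minor r s 3 2 4 2; 0; 0; 0];
          [:: 0; 0; 0; 0]; [:: 0; 0; 0; 0] ].
Proof.
rewrite /phi0 wedge_mx4 //; move: (minor _ _ _ _ _ _) => p.
by mx4_ops; mx4_congr; ring.
Qed.

Lemma phi1_mx4 r s : phi1 (mx4 r) (mx4 s) =
  let p := minor r s 3 2 4 2 in
  mx4 [:: [:: p; 0; 0; 0];
          [:: minor r s 3 1 4 2 + minor r s 3 2 4 1; - p; 0; 0];
          [:: 0; 0; 0; 0]; [:: 0; 0; 0; 0] ].
Proof.
rewrite /phi1 /= !wedge_mx4 //; do 3!move: (minor _ _ _ _ _ _) => ?.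
by mx4_ops; mx4_congr; ring.
Qed.

Lemma phi2_mx4 r s : phi2 (mx4 r) (mx4 s) =
  let p := minor r s 3 1 4 2 + minor r s 3 2 4 1 in
  mx4 [:: [:: p; minor r s 4 2 3 2; 0; 0]; [:: minor r s 3 1 4 1; - p; 0; 0];
          [:: 0; 0; 0; 0]; [:: 0; 0; 0; 0] ].
Proof.
rewrite /phi2 /= !wedge_mx4 //; do 4!move: (minor _ _ _ _ _ _) => ?.
by mx4_ops; mx4_congr; ring.
Qed.

Lemma psi0_mx4 r s : psi0 (mx4 r) (mx4 s) =
  mx4 [:: [:: 0; 0; 0; 0]; [:: 0; 0; 0; 0];
          [:: 0; 0; 0; 0]; [:: 0; 0; minor r s 3 2 3 1; 0] ].
Proof.
rewrite /psi0 wedge_mx4 //; move: (minor _ _ _ _ _ _) => p.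
by mx4_ops; mx4_congr; ring.
Qed.

Lemma psi2_mx4 r s : psi2 (mx4 r) (mx4 s) =
  let p := minor r s 4 2 3 1 + minor r s 3 2 4 1 in
  mx4 [:: [:: 0; 0; 0; 0]; [:: 0; 0; 0; 0];
          [:: 0; 0; - p; minor r s 3 1 3 2]; [:: 0; 0; minor r s 4 2 4 1; p] ].
Proof.
rewrite /psi2 /= !wedge_mx4 //; do 4!move: (minor _ _ _ _ _ _) => ?.
by mx4_ops; mx4_congr; ring.
Qed.

End ExplicitCurvature.

Ltac mx4_step :=
  first
    [ mx4_op
    | match goal with
      | |- context [phi0 (mx4 ?r) (mx4 ?s)] => rewrite (phi0_mx4 r s)
      | |- context [phi1 (mx4 ?r) (mx4 ?s)] => rewrite (phi1_mx4 r s)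
      | |- context [phi2 (mx4 ?r) (mx4 ?s)] => rewrite (phi2_mx4 r s)
      | |- context [psi0 (mx4 ?r) (mx4 ?s)] => rewrite (psi0_mx4 r s)
      | |- context [psi2 (mx4 ?r) (mx4 ?s)] => rewrite (psi2_mx4 r s)
      end;
      cbv beta iota zeta delta [minor entry nth predn] ].

Ltac mx4_expand :=
  repeat (match goal with x := _ |- _ => subst x end);
  rewrite /H /curvature /M9 /M8 /M7 /M6S /M6N /lieb; repeat mx4_step.

Ltac entry_field := by field; rewrite ?pnatr_eq0.

Ltac mx4_field := mx4_expand; mx4_congr; entry_field.

(** Membership in a parametrized family: each parameter is read off from an
    entry where it stands alone, and the other entries are then identities. *)
Ltac mx4_param :=
  hnf; repeat (match goal with |- exists _, _ => eexists end);
  repeat (match goal with |- 0 = _ => rewrite mx4_0 end);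
  mx4_expand; mx4_congr;
  try (match goal with |- _ = ?x => is_evar x; reflexivity end);
  entry_field.

(** Hypotheses are compared syntactically: deciding whether two different
    explicit matrices are convertible is prohibitively slow. *)
Ltac hol_member :=
  match goal with hB : hol_stable ?M ?B |- ?B _ =>
    let sB := fresh in let cB := fresh in let bB := fresh in
    case: (hB) => sB cB bB;
    repeat first
      [ match goal with h : ?P |- ?Q => constr_eq P Q; exact h end
      | match goal with
        | |- B (lieb _ _) => apply: bB
        | |- B (curvature _ _ _) => apply: cB
        | |- B (_ - _) => apply: (subspaceB sB)
        | |- B (_ + _) => apply: (subspaceD sB)
        | |- B (_ *: _) => apply: (subspaceZ sB)
        end ]
  end.

(** Closes a goal [B x], where [B] is stable, from an expression [e] of [x]
    through vectors known to be in [B], curvature values and brackets with the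
    model space. *)
Ltac hol_from e :=
  match goal with |- ?B ?x =>
    let xe := fresh in
    have xe : x = e; [ mx4_field | rewrite xe; clear xe; hol_member; fail ]
  end.

(** * The models with nilpotent holonomy: M9 and M7 *)

Section NilpotentHolonomy.
Variable K : numFieldType.
Local Notation E := (E K).
Local Notation H := (H K).

Definition first_column : set 'M[K]_4 :=
  [set x | exists u1 u2 u3 : K,
    x = mx4 [:: [::  0; 0; 0; 0];
                [:: u1; 0; 0; 0];
                [:: u2; 0; 0; 0];
                [:: u3; 0; 0; 0] ]].

Lemma first_column_min (B : set 'M[K]_4) : subspace B ->
  B (E 2 1) -> B (E 3 1) -> B (E 4 1) -> first_column `<=` B.
Proof.
move=> sB B1 B2 B3 _ [u1 [u2 [u3 ->]]].
rewrite (_ : mx4 _ = u1 *: E 2 1 + u2 *: E 3 1 + u3 *: E 4 1);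
  last by mx4_field.
by do ![apply: subspaceD | apply: subspaceZ].
Qed.

Lemma subspace_first_column : subspace first_column.
Proof.
split; first by mx4_param.
by move=> c _ _ [u1 [u2 [u3 ->]]] [v1 [v2 [v3 ->]]]; mx4_param.
Qed.

Lemma hol_M9 : hol (M9 K) = first_column.
Proof.
apply: hol_eq => [|B hB].
  split; first exact: subspace_first_column.
  - move=> _ _ [z [h [s [t [a1 [a2 [a3 [a4 [a5 ->]]]]]]]]]
      [z' [h' [s' [t' [b1 [b2 [b3 [b4 [b5 ->]]]]]]]]].
    by mx4_param.
  - move=> _ _ [z [h [s [t [a1 [a2 [a3 [a4 [a5 ->]]]]]]]]] [u1 [u2 [u3 ->]]].
    by mx4_param.
have f1 : cspace (M9 K) (E 3 2) by exists 0, 0, 0, 0, 1, 0, 0, 0, 0; mx4_field.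
have f2 : cspace (M9 K) (E 4 2) by exists 0, 0, 0, 0, 0, 1, 0, 0, 0; mx4_field.
have B21 : B (E 2 1) by hol_from (curvature (M9 K) (E 3 2) (E 4 2)).
have B31 : B (E 3 1) by hol_from (lieb (E 3 2) (E 2 1)).
have B41 : B (E 4 1) by hol_from (lieb (E 4 2) (E 2 1)).
by apply: first_column_min B21 B31 B41; case: hB.
Qed.

Lemma hol_M7_flat a : a ^+ 2 = 4 / 3 -> hol (M7 a) = first_column.
Proof.
move=> a2E; pose g := - (a / 2); pose f := a ^+ 2 / 4 + 5.
have c0 : 12 * (a ^+ 2 - 4 / 3) = 0 by rewrite a2E subrr mulr0.
apply: hol_eq => [|B hB].
  split; first exact: subspace_first_column.
  - move=> _ _ [z [t [a1 [a2 [a3 [a4 [a5 ->]]]]]]]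
      [z' [t' [b1 [b2 [b3 [b4 [b5 ->]]]]]]].
    by rewrite /M7 /= c0 scale0r addr0; mx4_param.
  - move=> _ _ [z [t [a1 [a2 [a3 [a4 [a5 ->]]]]]]] [u1 [u2 [u3 ->]]].
    by mx4_param.
(* The element of the model with all parameters zero except [a1 = 1]. *)
pose X1 := - g *: (E 1 1 - E 2 2 - E 3 3 + E 4 4) + f *: E 2 3 + E 3 2.
have f1 : cspace (M7 a) X1 by exists 0, 0, 1, 0, 0, 0, 0; mx4_field.
have f2 : cspace (M7 a) (E 4 2) by exists 0, 0, 0, 1, 0, 0, 0; mx4_field.
have B21 : B (E 2 1).
  have: B (curvature (M7 a) X1 (E 4 2)) by hol_member.
  by rewrite /= c0 scale0r addr0; congr (B _); mx4_field.
have B31 : B (E 3 1) by hol_from (lieb X1 (E 2 1) - (2 * g) *: E 2 1).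
have B41 : B (E 4 1) by hol_from (lieb (E 4 2) (E 2 1)).
by apply: first_column_min B21 B31 B41; case: hB.
Qed.

Lemma hol_M7_curved a : a ^+ 2 <> 4 / 3 -> hol (M7 a) =
  [set x | exists u1 u2 u3 u4 u5 : K,
    x = mx4 [:: [::  0;  0;  0; 0];
                [:: u1;  0;  0; 0];
                [:: u2;  0;  0; 0];
                [:: u3; u4; u5; 0] ]].
Proof.
move=> a2N; pose g := - (a / 2); pose f := a ^+ 2 / 4 + 5.
pose c := 12 * (a ^+ 2 - 4 / 3).
have c0 : c != 0.
  by rewrite mulf_neq0 ?pnatr_eq0 // subr_eq0; apply/eqP.
apply: hol_eq => [|B hB _ [u1 [u2 [u3 [u4 [u5 ->]]]]]].
  split; first split.
  - by mx4_param.
  - move=> d _ _ [u1 [u2 [u3 [u4 [u5 ->]]]]] [v1 [v2 [v3 [v4 [v5 ->]]]]].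
    by mx4_param.
  - move=> _ _ [z [t [a1 [a2 [a3 [a4 [a5 ->]]]]]]]
      [z' [t' [b1 [b2 [b3 [b4 [b5 ->]]]]]]].
    by mx4_param.
  - move=> _ _ [z [t [a1 [a2 [a3 [a4 [a5 ->]]]]]]]
      [u1 [u2 [u3 [u4 [u5 ->]]]]].
    by mx4_param.
(* The element of the model with all parameters zero except [a1 = 1]. *)
pose X1 := - g *: (E 1 1 - E 2 2 - E 3 3 + E 4 4) + f *: E 2 3 + E 3 2.
have f1 : cspace (M7 a) X1 by exists 0, 0, 1, 0, 0, 0, 0; mx4_field.
have f2 : cspace (M7 a) (E 4 2) by exists 0, 0, 0, 1, 0, 0, 0; mx4_field.
have f4 : cspace (M7 a) (E 3 1) by exists 0, 0, 0, 0, 0, 1, 0; mx4_field.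
have B21 : B (E 2 1) by hol_from (curvature (M7 a) X1 (E 4 2)).
have B43 : B (E 4 3).
  have: B (c^-1 *: curvature (M7 a) X1 (E 3 1)) by hol_member.
  congr (B _); rewrite -[RHS]scale1r -(mulVf c0) -scalerA; congr (_ *: _).
  by mx4_field.
have B31 : B (E 3 1) by hol_from (lieb X1 (E 2 1) - (2 * g) *: E 2 1).
have B41 : B (E 4 1) by hol_from (lieb (E 4 2) (E 2 1)).
have B42 : B (E 4 2) by hol_from ((- 2 * g) *: E 4 3 - lieb X1 (E 4 3)).
by hol_from (u1 *: E 2 1 + u2 *: E 3 1 + u3 *: E 4 1 + u4 *: E 4 2 +
  u5 *: E 4 3).
Qed.

End NilpotentHolonomy.

(** * M8 and the symplectic algebra *)

Section M8Holonomy.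
Variable K : numFieldType.
Local Notation E := (E K).
Local Notation H := (H K).

Definition hol8 : set 'M[K]_4 :=
  [set x | exists s1 s2 s3 c1 c2 c3 c4 t1 t2 t3 : K,
    x = mx4 [:: [:: s1;   s2;     c4 / 2; - (c2 / 2)];
                [:: s3; - s1; - (c3 / 2);     c1 / 2];
                [:: c1;   c2;         t1;         t2];
                [:: c3;   c4;         t3;       - t1] ]].

(** The vectors [X1], ..., [X4] are eigenvectors of the bracket with [H12],
    itself a curvature value; this is what puts them in the holonomy. *)
Lemma hol_M8 : hol (M8 K) = hol8.
Proof.
apply: hol_eq => [|B hB _ [s1 [s2 [s3 [c1 [c2 [c3 [c4 [t1 [t2 [t3 ->]]]]]]]]]]].
  split; first split.
  - by mx4_param.
  - move=> d _ _ [s1 [s2 [s3 [c1 [c2 [c3 [c4 [t1 [t2 [t3 ->]]]]]]]]]]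
      [s1' [s2' [s3' [c1' [c2' [c3' [c4' [t1' [t2' [t3' ->]]]]]]]]]].
    by mx4_param.
  - move=> _ _ [s [t1 [t2 [t3 [a1 [a2 [a3 [a4 ->]]]]]]]]
      [s' [t1' [t2' [t3' [b1 [b2 [b3 [b4 ->]]]]]]]].
    by mx4_param.
  - move=> _ _ [s [t1 [t2 [t3 [a1 [a2 [a3 [a4 ->]]]]]]]]
      [s1 [s2 [s3 [c1 [c2 [c3 [c4 [u1 [u2 [u3 ->]]]]]]]]]].
    by mx4_param.
pose X1 := E 3 2 - 2^-1 *: E 1 4; pose X2 := E 4 2 + 2^-1 *: E 1 3.
pose X3 := E 3 1 + 2^-1 *: E 2 4; pose X4 := E 4 1 - 2^-1 *: E 2 3.
have f1 : cspace (M8 K) X1 by exists 0, 0, 0, 0, 1, 0, 0, 0; mx4_field.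
have f2 : cspace (M8 K) X2 by exists 0, 0, 0, 0, 0, 1, 0, 0; mx4_field.
have f3 : cspace (M8 K) X3 by exists 0, 0, 0, 0, 0, 0, 1, 0; mx4_field.
have f4 : cspace (M8 K) X4 by exists 0, 0, 0, 0, 0, 0, 0, 1; mx4_field.
have B21 : B (E 2 1) by hol_from (curvature (M8 K) X3 X4).
have B12 : B (E 1 2) by hol_from (curvature (M8 K) X2 X1).
have B11 : B (H 1 2) by hol_from (curvature (M8 K) X3 X2).
have BX1 : B X1 by hol_from (-1 *: lieb X1 (H 1 2)).
have BX2 : B X2 by hol_from (-1 *: lieb X2 (H 1 2)).
have BX3 : B X3 by hol_from (lieb X3 (H 1 2)).
have BX4 : B X4 by hol_from (lieb X4 (H 1 2)).
have B34 : B (E 3 4) by hol_from (lieb X1 X3).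
have B43 : B (E 4 3) by hol_from (-1 *: lieb X2 X4).
have B33 : B (H 3 4) by hol_from (H 1 2 - 2 *: lieb X2 X3).
by hol_from (s1 *: H 1 2 + s2 *: E 1 2 + s3 *: E 2 1 +
  c1 *: X3 + c2 *: X1 + c3 *: X4 + c4 *: X2 +
  t1 *: H 3 4 + t2 *: E 3 4 + t3 *: E 4 3).
Qed.

End M8Holonomy.

Definition form_algebra (n : nat) (K : fieldType) (G : 'M[K]_n) : set 'M[K]_n :=
  [set x | x^T *m G + G *m x = 0].

Lemma form_algebra_subalgebra n (K : fieldType) (G : 'M[K]_n) :
  lie_subalgebra (form_algebra G).
Proof.
split=> [|c x y xG yG|x y]; rewrite /form_algebra /=.
- by rewrite trmx0 mul0mx mulmx0 addr0.
- rewrite linearP /= mulmxDl mulmxDr -scalemxAl -scalemxAr addrACA -scalerDr.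
  by rewrite xG yG scaler0 addr0.
move=> /eqP; rewrite addr_eq0 => /eqP xG /eqP; rewrite addr_eq0 => /eqP yG.
rewrite /lieb linearB /= !trmx_mul mulmxBl mulmxBr -(mulmxA y^T) -(mulmxA x^T).
rewrite xG yG !mulmxN !mulmxA xG yG !mulNmx !opprK.
by rewrite addrA subrK subrr.
Qed.

(** A change of basis [P] carrying one form to the other conjugates their
    infinitesimal symmetries. *)
Lemma form_algebra_congruence n (K : fieldType) (G J P : 'M[K]_n) :
  P \in unitmx -> G = P^T *m J *m P ->
  lie_isomorphic (form_algebra G) (form_algebra J).
Proof.
move=> Pu GE; split; [exact: form_algebra_subalgebra.. |].
have PTu : P^T \in unitmx by rewrite unitmx_tr.
exists (fun x => P *m x *m invmx P); split; last first.
- move=> x y _ _; rewrite /lieb mulmxBr mulmxBl !mulmxA.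
  by rewrite !(mulmxKV Pu).
- by move=> c x y _ _; rewrite mulmxDr mulmxDl -scalemxAr -scalemxAl.
split=> [x xG|x y _ _ /(congr1 (fun z => invmx P *m z *m P))|y yJ].
- have -> : form_algebra J (P *m x *m invmx P) =
    ((invmx P)^T *m (x^T *m G + G *m x) *m invmx P = 0).
    rewrite /form_algebra /= GE !trmx_mul mulmxDr mulmxDl !mulmxA.
    by rewrite trmx_inv (mulVmx PTu) mul1mx (mulmxK Pu).
  by rewrite xG mulmx0 mul0mx.
- by rewrite !mulmxA (mulVmx Pu) !mul1mx !(mulmxKV Pu).
exists (invmx P *m y *m P);
  last by rewrite !mulmxA (mulmxV Pu) mul1mx mulmxK.
have -> : form_algebra G (invmx P *m y *m P) =
  (P^T *m (y^T *m J + J *m y) *m P = 0).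
  rewrite /form_algebra /= GE !trmx_mul mulmxDr mulmxDl !mulmxA.
  by rewrite trmx_inv (mulmxKV PTu) (mulmxK Pu).
by rewrite yJ mulmx0 mul0mx.
Qed.

Section M8Symplectic.
Variable K : numFieldType.

(** The off-diagonal blocks of the M8 family are tied to each other with ratio
    1/2 up to sign, which forces the weights -2 and 1 on the two planes. *)
Definition form8 : 'M[K]_4 :=
  mx4 [:: [:: 0; -2; 0; 0]; [:: 2; 0; 0; 0];
          [:: 0; 0; 0; 1]; [:: 0; 0; -1; 0] ].

(** The columns are e1, -2 e3, e2, e4, where (e1, e3) and (e2, e4) are the
    hyperbolic pairs of the standard form. *)
Definition frame8 : 'M[K]_4 :=
  mx4 [:: [:: 1; 0; 0; 0]; [:: 0; 0; 1; 0]; [:: 0; -2; 0; 0]; [:: 0; 0; 0; 1] ].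

Definition sp4_form : 'M[K]_4 :=
  block_mx (0 : 'M[K]_2) 1%:M (- 1%:M) 0.

Lemma sp4_formE : sp4_form =
  mx4 [:: [:: 0; 0; 1; 0]; [:: 0; 0; 0; 1];
          [:: -1; 0; 0; 0]; [:: 0; -1; 0; 0] ].
Proof.
apply/matrixP => i j; rewrite !mxE.
by case: splitP => k ->; rewrite !mxE; case: splitP => l ->; rewrite !mxE;
  case: k l => [[|[|k]] //= _] [[|[|l]] //= _]; rewrite ?oppr0.
Qed.

Lemma form8_frame : form8 = frame8^T *m sp4_form *m frame8.
Proof. by rewrite sp4_formE /form8 /frame8; mx4_field. Qed.

Lemma frame8_unit : frame8 \in unitmx.
Proof.
apply: (mulmx1_unit (B := mx4
  [:: [:: 1; 0; 0; 0]; [:: 0; 0; - (2^-1); 0];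
      [:: 0; 1; 0; 0]; [:: 0; 0; 0; 1] ]) _).1.
rewrite /frame8.
by rewrite mx4M; apply/matrixP => -[[|[|[|[|i]]]] //= ?] -[[|[|[|[|j]]]] //= ?];
  rewrite !mxE /entry /=; field; rewrite ?pnatr_eq0.
Qed.

(** Solving the linear equation [c = 0] for one of its unknowns. *)
Lemma eq_of_vanishing (k c a b : K) : c = 0 -> a = b + k * c -> a = b.
Proof. by move=> -> ->; rewrite mulr0 addr0. Qed.

Lemma hol8E : @hol8 K = form_algebra form8.
Proof.
apply/seteqP; split=> x /=.
  move=> [s1 [s2 [s3 [c1 [c2 [c3 [c4 [t1 [t2 [t3 ->]]]]]]]]]].
  by rewrite /form_algebra /= /form8 mx4_0; mx4_field.
have [u11 [u12 [u13 [u14 [u21 [u22 [u23 [u24 [u31 [u32 [u33 [u34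
  [u41 [u42 [u43 [u44 ->]]]]]]]]]]]]]]]] := mx4P x.
rewrite /form_algebra /= /form8 mx4_0; mx4_expand.
move=> /matrixP e.
have := e 0 1; rewrite !mxE /= => e12.
have := e 0 2; rewrite !mxE /= => e13.
have := e 0 3; rewrite !mxE /= => e14.
have := e 1 2; rewrite !mxE /= => e23.
have := e 1 3; rewrite !mxE /= => e24.
have := e 2 3; rewrite !mxE /= => e34.
have -> : u22 = - u11.
  by apply: (eq_of_vanishing (k := - 2^-1) e12); entry_field.
have -> : u23 = - (u41 / 2).
  by apply: (eq_of_vanishing (k := - 2^-1) e13); entry_field.
have -> : u24 = u31 / 2.
  by apply: (eq_of_vanishing (k := - 2^-1) e14); entry_field.
have -> : u13 = u42 / 2.
  by apply: (eq_of_vanishing (k := 2^-1) e23); entry_field.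
have -> : u14 = - (u32 / 2).
  by apply: (eq_of_vanishing (k := 2^-1) e24); entry_field.
have -> : u44 = - u33 by apply: (eq_of_vanishing (k := 1) e34); entry_field.
by exists u11, u12, u21, u31, u32, u41, u42, u33, u34, u43.
Qed.

Lemma hol8_sp4 : lie_isomorphic (@hol8 K) (@sp4 K).
Proof.
by rewrite hol8E; exact: form_algebra_congruence frame8_unit form8_frame.
Qed.

End M8Symplectic.

(** * The models M6S and M6N *)

Section ModelsM6.
Variable K : numFieldType.
Local Notation E := (E K).
Local Notation H := (H K).

Lemma tr_lieb n (x y : 'M[K]_n) : \tr (lieb x y) = 0.
Proof. by rewrite raddfB /= mxtrace_mulC subrr. Qed.

Lemma subspace_sl4 : subspace (@sl4 K).
Proof.
split=> [|c x y]; first exact: mxtrace0.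
by rewrite /sl4 /= mxtraceD mxtraceZ => -> ->; rewrite mulr0 addr0.
Qed.

Lemma hol_M6S : hol (M6S K) = @sl4 K.
Proof.
apply: hol_eq => [|B hB x].
  split; first exact: subspace_sl4.
  - move=> _ _ [s1 [s2 [a1 [a2 [a3 [a4 ->]]]]]]
      [t1 [t2 [b1 [b2 [b3 [b4 ->]]]]]].
    by rewrite /sl4 /=; mx4_expand; entry_field.
  - by move=> x y _ _; exact: tr_lieb.
pose X1 := E 3 2 + (19 / 6) *: E 1 4; pose X2 := E 4 2 + (11 / 6) *: E 1 3.
pose X3 := E 3 1 + (11 / 6) *: E 2 4; pose X4 := E 4 1 + (19 / 6) *: E 2 3.
have f1 : cspace (M6S K) X1 by exists 0, 0, 1, 0, 0, 0; mx4_field.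
have f2 : cspace (M6S K) X2 by exists 0, 0, 0, 1, 0, 0; mx4_field.
have f3 : cspace (M6S K) X3 by exists 0, 0, 0, 0, 1, 0; mx4_field.
have f4 : cspace (M6S K) X4 by exists 0, 0, 0, 0, 0, 1; mx4_field.
have B12 : B (E 1 2) by hol_from ((3 / 4) *: curvature (M6S K) X1 X2).
have B21 : B (E 2 1) by hol_from ((3 / 4) *: curvature (M6S K) X4 X3).
have B34 : B (E 3 4) by hol_from ((3 / 4) *: curvature (M6S K) X3 X1).
have B43 : B (E 4 3) by hol_from ((3 / 4) *: curvature (M6S K) X2 X4).
have BH12 : B (H 1 2).
  by hol_from ((3 / 8) *: (curvature (M6S K) X2 X3 + curvature (M6S K) X4 X1)).
have BH34 : B (H 3 4).
  by hol_from ((3 / 8) *: (curvature (M6S K) X4 X1 - curvature (M6S K) X2 X3)).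
have BX1 : B X1 by hol_from (-1 *: lieb X1 (H 1 2)).
have BX2 : B X2 by hol_from (-1 *: lieb X2 (H 1 2)).
have BX3 : B X3 by hol_from (lieb X3 (H 1 2)).
have BX4 : B X4 by hol_from (lieb X4 (H 1 2)).
(* [X2] pairs [E42] with [E13] in ratio 11/6 and [X1] pairs [E32] with [E14] in
   ratio 19/6; bracketing with [E34] turns the former pair into the latter with
   ratio -11/6, and 1/5 is the inverse of 19/6 + 11/6. *)
have B14 : B (E 1 4) by hol_from ((1 / 5) *: (X1 + lieb X2 (E 3 4))).
have B13 : B (E 1 3) by hol_from ((1 / 5) *: (X2 + lieb X1 (E 4 3))).
have B24 : B (E 2 4) by hol_from ((1 / 5) *: (X3 + lieb X4 (E 3 4))).
have B23 : B (E 2 3) by hol_from ((1 / 5) *: (X4 + lieb X3 (E 4 3))).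
have B32 : B (E 3 2) by hol_from (X1 - (19 / 6) *: E 1 4).
have B42 : B (E 4 2) by hol_from (X2 - (11 / 6) *: E 1 3).
have B31 : B (E 3 1) by hol_from (X3 - (11 / 6) *: E 2 4).
have B41 : B (E 4 1) by hol_from (X4 - (19 / 6) *: E 2 3).
have BH13 : B (H 1 3) by hol_from (-1 *: lieb X3 (E 1 3)).
have BH23 : B (H 2 3) by hol_from (H 1 3 - H 1 2).
have [u11 [u12 [u13 [u14 [u21 [u22 [u23 [u24 [u31 [u32 [u33 [u34
  [u41 [u42 [u43 [u44 ->]]]]]]]]]]]]]]]] := mx4P x.
rewrite /sl4 /= mx4_tr /entry /= => tr0.
have -> : u44 = - (u11 + u22 + u33) by rewrite -[LHS]subr0 -tr0; ring.
by hol_from (u12 *: E 1 2 + u13 *: E 1 3 + u14 *: E 1 4 +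
  u21 *: E 2 1 + u23 *: E 2 3 + u24 *: E 2 4 +
  u31 *: E 3 1 + u32 *: E 3 2 + u34 *: E 3 4 +
  u41 *: E 4 1 + u42 *: E 4 2 + u43 *: E 4 3 +
  u11 *: H 1 2 + (u11 + u22) *: H 2 3 + (u11 + u22 + u33) *: H 3 4).
Qed.

Lemma hol_M6N : hol (M6N K) =
  [set x | @sl4 K x /\
    exists u11 u21 u22 u23 u24 u31 u32 u33 u34 u41 u42 u43 u44 : K,
    x = mx4 [:: [:: u11;   0;   0;   0];
                [:: u21; u22; u23; u24];
                [:: u31; u32; u33; u34];
                [:: u41; u42; u43; u44] ]].
Proof.
apply: hol_eq => [|B hB x [tr0 [u11 [u21 [u22 [u23 [u24 [u31 [u32 [u33
    [u34 [u41 [u42 [u43 [u44 xE]]]]]]]]]]]]]]].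
  split; first split.
  - by split; [exact: mxtrace0 | mx4_param].
  - move=> c x y [tx [u11 [u21 [u22 [u23 [u24 [u31 [u32 [u33
      [u34 [u41 [u42 [u43 [u44 xE]]]]]]]]]]]]]]
      [ty [v11 [v21 [v22 [v23 [v24 [v31 [v32 [v33
      [v34 [v41 [v42 [v43 [v44 yE]]]]]]]]]]]]]].
    split; [exact: subspace_sl4.2 | rewrite xE yE; mx4_param].
  - move=> _ _ [z [t [b1 [b2 [b3 [b4 ->]]]]]] [z' [t' [c1 [c2 [c3 [c4 ->]]]]]].
    split; last by mx4_param.
    by rewrite /sl4 /=; mx4_expand; entry_field.
  - move=> x y [z [t [b1 [b2 [b3 [b4 xE]]]]]]
      [_ [u11 [u21 [u22 [u23 [u24 [u31 [u32 [u33
      [u34 [u41 [u42 [u43 [u44 yE]]]]]]]]]]]]]].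
    by split; [exact: tr_lieb | rewrite xE yE; mx4_param].
(* The elements of the model whose only nonzero parameter is [b1], [b2] or [b3],
   equal to 1. *)
pose X1 : 'M[K]_4 := mx4 [:: [:: - (1 / 2); 0; 0; 0];
                             [:: 0; 1 / 2; - (5 / 48); 5];
                             [:: 0; 1; - (1 / 6); 16];
                             [:: 0; 0; 0; 1 / 6] ].
pose X2 : 'M[K]_4 := mx4 [:: [:: 0; 0; 0; 0];
                             [:: 0; 0; -5; 0];
                             [:: 0; 0; -16; 0];
                             [:: 0; 1; 0; 16] ].
pose X3 := 4^-1 *: E 2 1 + E 3 1.
have f43 : cspace (M6N K) (E 4 3) by exists 0, 1, 0, 0, 0, 0; mx4_field.
have f1 : cspace (M6N K) X1 by exists 0, 0, 1, 0, 0, 0; mx4_field.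
have f2 : cspace (M6N K) X2 by exists 0, 0, 0, 1, 0, 0; mx4_field.
have f3 : cspace (M6N K) X3 by exists 0, 0, 0, 0, 1, 0; mx4_field.
have BH12 : B (H 1 2) by hol_from (curvature (M6N K) X1 X2).
have B21 : B (E 2 1) by hol_from (curvature (M6N K) X3 X2).
have B31 : B (E 3 1) by hol_from (lieb X1 (E 2 1) - E 2 1).
have B41 : B (E 4 1) by hol_from (lieb X2 (E 2 1)).
(* From here on the chain stays in the lower right 3x3 block. *)
pose Y1 := E 3 2 + (5 / 48) *: E 2 3 - 5 *: E 2 4.
have BY1 : B Y1 by hol_from (-1 *: lieb X1 (H 1 2)).
pose Y2 := E 4 2 + 5 *: E 2 3.
have BY2 : B Y2 by hol_from (-1 *: lieb X2 (H 1 2)).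
have B43 : B (E 4 3) by hol_from (10^-1 *: (lieb X2 Y2 - 16 *: Y2)).
pose Q := 5 *: E 2 3 + 8 *: H 3 4.
have BQ : B Q by hol_from (2^-1 *: (lieb X1 (E 4 3) + Y2 - 3^-1 *: E 4 3)).
pose Z1 := - (5 / 24) *: H 2 3 + (5 / 36) *: E 2 3 - (20 / 3) *: E 2 4
  - 10 *: E 3 4.
have BZ1 : B Z1 by hol_from (lieb X1 Y1 + (2 / 3) *: Y1).
have B23 : B (E 2 3).
  by hol_from ((12 / 5) *:
    (lieb (E 4 3) Z1 - (5 / 24) *: E 4 3 - (5 / 4) *: Q)).
have B42 : B (E 4 2) by hol_from (Y2 - 5 *: E 2 3).
have BH34 : B (H 3 4) by hol_from (8^-1 *: (Q - 5 *: E 2 3)).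
pose V := H 2 3 + 16 *: E 2 4.
have BV : B V by hol_from ((2 / 3) *: E 2 3 - lieb X1 (E 2 3)).
pose T := 5 *: E 2 4 + E 3 2 + 32 *: E 3 4.
have BT : B T by hol_from (-1 *: lieb X1 (H 3 4) - (5 / 48) *: E 2 3).
pose Y := E 3 2 - 5 *: E 2 4.
have BY : B Y by hol_from (Y1 - (5 / 48) *: E 2 3).
pose W := (10 / 3) *: E 2 4 + 10 *: E 3 4.
have BW : B W by hol_from (-1 *: (Z1 + (5 / 24) *: V - (5 / 36) *: E 2 3)).
(* [T - Y] = 10 E24 + 32 E34 and [W] are independent, hence span the plane of
   [E24] and [E34]. *)
have B34 : B (E 3 4) by hol_from (2^-1 *: (T - Y - 3 *: W)).
have B24 : B (E 2 4) by hol_from (10^-1 *: (T - Y - 32 *: E 3 4)).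
have B32 : B (E 3 2) by hol_from (Y + 5 *: E 2 4).
have BH23 : B (H 2 3) by hol_from (V - 16 *: E 2 4).
move: tr0; rewrite xE /sl4 /= mx4_tr /entry /= => tr0.
have -> : u44 = - (u11 + u22 + u33) by rewrite -[LHS]subr0 -tr0; ring.
by hol_from (u21 *: E 2 1 + u23 *: E 2 3 + u24 *: E 2 4 +
  u31 *: E 3 1 + u32 *: E 3 2 + u34 *: E 3 4 +
  u41 *: E 4 1 + u42 *: E 4 2 + u43 *: E 4 3 +
  u11 *: H 1 2 + (u11 + u22) *: H 2 3 + (u11 + u22 + u33) *: H 3 4).
Qed.

End ModelsM6.

Theorem theorem5p8 (R : realType) :
  [/\ hol (M9 R[i]) =
        [set x | exists u1 u2 u3 : R[i],
          x = mx4 [:: [::  0; 0; 0; 0];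
                      [:: u1; 0; 0; 0];
                      [:: u2; 0; 0; 0];
                      [:: u3; 0; 0; 0] ]],
      hol (M8 R[i]) =
        [set x | exists s1 s2 s3 c1 c2 c3 c4 t1 t2 t3 : R[i],
          x = mx4 [:: [:: s1;   s2;     c4 / 2; - (c2 / 2)];
                      [:: s3; - s1; - (c3 / 2);     c1 / 2];
                      [:: c1;   c2;         t1;         t2];
                      [:: c3;   c4;         t3;       - t1] ]]
      /\ lie_isomorphic (hol (M8 R[i])) (@sp4 R[i]),
      (forall a : R[i], a ^+ 2 <> 4 / 3 ->
        hol (M7 a) =
          [set x | exists u1 u2 u3 u4 u5 : R[i],
            x = mx4 [:: [::  0;  0;  0; 0];
                        [:: u1;  0;  0; 0];
                        [:: u2;  0;  0; 0];
                        [:: u3; u4; u5; 0] ]])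
      /\ (forall a : R[i], a ^+ 2 = 4 / 3 ->
        hol (M7 a) =
          [set x | exists u1 u2 u3 : R[i],
            x = mx4 [:: [::  0; 0; 0; 0];
                        [:: u1; 0; 0; 0];
                        [:: u2; 0; 0; 0];
                        [:: u3; 0; 0; 0] ]]),
      hol (M6S R[i]) = @sl4 R[i]
    & hol (M6N R[i]) =
        [set x | @sl4 R[i] x /\
          exists u11 u21 u22 u23 u24 u31 u32 u33 u34 u41 u42 u43 u44 : R[i],
          x = mx4 [:: [:: u11;   0;   0;   0];
                      [:: u21; u22; u23; u24];
                      [:: u31; u32; u33; u34];
                      [:: u41; u42; u43; u44] ]] ].
Proof.
split; first exact: hol_M9.
- by rewrite hol_M8; split; [| exact: hol8_sp4].
- by split=> a; [exact: hol_M7_curved | exact: hol_M7_flat].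
- exact: hol_M6S.
- exact: hol_M6N.
Qed.
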